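(* For every positive integer $a$, the $a$-floor quotient relation $\preccurlyeq_a$ defines a partial order $\mathcal{Q}_a := (\mathbb{N}^+, \preccurlyeq_a)$ on the positive integers. Moreover, for each integer $a \ge 1$, the partial order $\mathcal{Q}_a$ is an approximate divisor order.
   Context: $\mathbb{N}^+ = \{1,2,3,\ldots\}$. For positive integers $d, n$, one says $d$ is a floor quotient of $n$, written $d \preccurlyeq_1 n$, if $d = \lfloor n/k \rfloor$ for some positive integer $k$. For an integer $a \ge 1$, one says $d$ is an $a$-floor quotient of $n$, written $d \preccurlyeq_a n$, if and only if $ad \preccurlyeq_1 an$ (i.e. there is a positive integer $k$ with $ad = \lfloor an/k \rfloor$). A partial order $(\mathbb{N}^+, \preccurlyeq)$ is called an approximate divisor order if for all $d, n \in \mathbb{N}^+$: (1) $d \mid n$ implies $d \preccurlyeq n$; and (2) $d \preccurlyeq n$ implies $d \le n$. *)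

(* Defs.v *)
From Stdlib Require Export PArith ZArith Relation_Definitions.

(* N^+ is Stdlib's [positive].  The quotient [n / k] is taken in [Z], because
   it may be 0 and [positive] has no division; [Z.div] rounds towards minus
   infinity, so it is the floor of the rational n / k. *)
Definition floor_quotient (d n : positive) : Prop :=
  exists k : positive, Z.pos d = (Z.pos n / Z.pos k)%Z.

Definition a_floor_quotient (a d n : positive) : Prop :=
  floor_quotient (a * d)%positive (a * n)%positive.

Record approximate_divisor_order (R : relation positive) : Prop := {
  ado_order : order positive R;
  ado_divide : forall d n : positive, (d | n)%positive -> R d n;
  ado_le : forall d n : positive, R d n -> (d <= n)%positive
}.

(* Main.v *)
Require Import Defs.
From Stdlib Require Import Lia.

(** Floor quotients compose because nested floors collapse:
    floor (floor (m / l) / k) = floor (m / (l k)).  This gives transitivity of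
    the floor quotient relation.  Dividing by an integer [k >= 1] cannot
    increase a number, so the relation refines [<=] and inherits antisymmetry
    from it, and exact division is a special case of floor division, so it
    contains divisibility (in particular it is reflexive).

    The a-floor quotient relation is the pullback of the floor quotient relation
    along [x => a * x].  This map reflects [<=] and preserves divisibility, so
    all these properties pull back. *)

Lemma floor_quotient_divide (d n : positive) :
  (d | n)%positive -> floor_quotient d n.
Proof.
  intros [q ->]. exists q.
  rewrite Pos2Z.inj_mul, Z.mul_comm, Z.div_mul; [reflexivity | discriminate].
Qed.

Lemma floor_quotient_le (d n : positive) :
  floor_quotient d n -> (d <= n)%positive.
Proof.
  intros [k Hk].
  assert (H : (Z.pos n / Z.pos k <= Z.pos n)%Z) by (apply Z.div_le_upper_bound; nia).
  lia.
Qed.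

Lemma floor_quotient_trans (d n m : positive) :
  floor_quotient d n -> floor_quotient n m -> floor_quotient d m.
Proof.
  intros [k Hk] [l Hl]. exists (l * k)%positive.
  rewrite Hk, Hl, Pos2Z.inj_mul. apply Z.div_div; lia.
Qed.

Lemma a_floor_quotient_divide (a d n : positive) :
  (d | n)%positive -> a_floor_quotient a d n.
Proof.
  intros [q ->]. apply floor_quotient_divide. exists q. lia.
Qed.

Lemma a_floor_quotient_le (a d n : positive) :
  a_floor_quotient a d n -> (d <= n)%positive.
Proof.
  intros H. apply floor_quotient_le in H. nia.
Qed.

Lemma a_floor_quotient_order (a : positive) :
  order positive (a_floor_quotient a).
Proof.
  split.
  - intros d. apply a_floor_quotient_divide. exists 1%positive. reflexivity.
  - intros d n m. apply floor_quotient_trans.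
  - intros d n Hdn Hnd. apply a_floor_quotient_le in Hdn, Hnd. lia.
Qed.

Theorem theorem1p3 (a : positive) :
  order positive (a_floor_quotient a) /\
  approximate_divisor_order (a_floor_quotient a).
Proof.
  split; [| split].
  - apply a_floor_quotient_order.
  - apply a_floor_quotient_order.
  - apply a_floor_quotient_divide.
  - apply a_floor_quotient_le.
Qed.
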